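(* Let $D_{(=,\leq)}(x)$ be the generating function, with respect to the length, for the total number of descents over all Catalan words avoiding the ordered pair of relations $(=,\leq)$. Then $$D_{(=,\leq)}(x)=\frac{1 - 2 x - x^2 - 2 x^3 -(1-x) \sqrt{1 - 2 x - 3 x^2 - 4 x^3}}{2 x\sqrt{1 - 2 x - 3 x^2 - 4 x^3}}.$$
   Context: A Catalan word of length $n$ is a word $w=w_1w_2\cdots w_n$ over the non-negative integers with $w_1=0$ and $0\leq w_i\leq w_{i-1}+1$ for $i=2,\dots,n$; the empty word is the unique Catalan word of length $0$. For relations $X,Y\in\{<,>,\leq,\geq,=,\neq\}$, a word $w$ contains the pattern $(X,Y)$ if there is an index $i\geq 1$ (with $i+2\le n$) such that $w_i\,X\,w_{i+1}$ and $w_{i+1}\,Y\,w_{i+2}$; otherwise $w$ avoids $(X,Y)$. The number of descents $\mathrm{des}(w)$ is the number of indices $i$ with $w_i>w_{i+1}$. With $C_{(X,Y)}(x,y)=\sum_{w}x^{|w|}y^{\mathrm{des}(w)}$, the sum being over all Catalan words $w$ (of any length $|w|\ge 0$) avoiding $(X,Y)$, one sets $D_{(X,Y)}(x)=\left.\frac{\partial C_{(X,Y)}(x,y)}{\partial y}\right|_{y=1}=\sum_w \mathrm{des}(w)\,x^{|w|}$. Identities are between formal power series in $x$ (after clearing denominators); the square root of a power series with constant term $1$ is the one with constant term $1$. *)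

(* Defs.v *)
From HB Require Import structures.
From mathcomp Require Import all_boot all_order all_algebra.
From mathcomp Require Import boolp classical_sets.
Set Implicit Arguments.
Unset Strict Implicit.
Unset Printing Implicit Defensive.
Import GRing.Theory.
Local Open Scope ring_scope.

(* Formal power series in one variable [x]; [f n] is the coefficient of x^n.
   A record rather than [nat -> R], so that [*] is the Cauchy product and not
   the pointwise product of functions. *)
Record fps (R : Type) := Fps { fps_coef :> nat -> R }.
Arguments Fps {R} _.

HB.instance Definition _ (R : Type) := gen_eqMixin (fps R).
HB.instance Definition _ (R : Type) := gen_choiceMixin (fps R).

Lemma fpsP (R : Type) (f g : fps R) : (forall n, f n = g n) -> f = g.
Proof. by case: f g => [f] [g] /= fg; congr Fps; apply/funext. Qed.

Section FpsRing.
Variable R : comNzRingType.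
Implicit Types f g h : fps R.

Definition fps_zero : fps R := Fps (fun=> 0).
Definition fps_one : fps R := Fps (fun n => (n == 0%N)%:R).
Definition fps_opp f : fps R := Fps (fun n => - f n).
Definition fps_add f g : fps R := Fps (fun n => f n + g n).
Definition fps_mul f g : fps R :=
  Fps (fun n => \sum_(i < n.+1) f i * g (n - i)%N).
Definition fpsX : fps R := Fps (fun n => (n == 1%N)%:R).

Fact fps_addA : associative fps_add.
Proof. by move=> f g h; apply: fpsP => n /=; rewrite addrA. Qed.
Fact fps_addC : commutative fps_add.
Proof. by move=> f g; apply: fpsP => n /=; rewrite addrC. Qed.
Fact fps_add0 : left_id fps_zero fps_add.
Proof. by move=> f; apply: fpsP => n /=; rewrite add0r. Qed.
Fact fps_addN : left_inverse fps_zero fps_opp fps_add.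
Proof. by move=> f; apply: fpsP => n /=; rewrite addNr. Qed.

HB.instance Definition _ :=
  GRing.isZmodule.Build (fps R) fps_addA fps_addC fps_add0 fps_addN.

Let trunc n f : {poly R} := \poly_(i < n.+1) f i.

Let coef_trunc n f i : (i <= n)%N -> (trunc n f)`_i = f i.
Proof. by move=> le_in; rewrite coef_poly ltnS le_in. Qed.

Fact fps_mul_trunc n f g i :
  (i <= n)%N -> fps_mul f g i = (trunc n f * trunc n g)`_i.
Proof.
move=> le_in; rewrite coefM; apply: eq_bigr => j _.
rewrite !coef_trunc //; first exact: leq_trans (leq_subr _ _) le_in.
by rewrite (leq_trans _ le_in) // -ltnS.
Qed.

Fact fps_mulC : commutative fps_mul.
Proof.
by move=> f g; apply: fpsP => n; rewrite !(@fps_mul_trunc n) // mulrC.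
Qed.

Fact fps_mulA : associative fps_mul.
Proof.
move=> f g h; apply: fpsP => n; rewrite /fps_mul /=.
transitivity (trunc n f * (trunc n g * trunc n h))`_n.
  rewrite coefM; apply: eq_bigr => i _.
  by rewrite coef_trunc -1?ltnS // -(fps_mul_trunc _ _ (leq_subr _ _)).
rewrite mulrA coefM; apply: eq_bigr => i _.
by rewrite coef_trunc ?leq_subr // -fps_mul_trunc // -ltnS.
Qed.

Fact fps_mul1 : left_id fps_one fps_mul.
Proof.
move=> f; apply: fpsP => n /=; rewrite big_ord_recl /= mul1r subn0.
by rewrite big1 ?addr0 // => i _; rewrite mul0r.
Qed.

Fact fps_mulDl : left_distributive fps_mul +%R.
Proof.
move=> f g h; apply: fpsP => n /=; rewrite -big_split /=.
by apply: eq_bigr => i _; rewrite mulrDl.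
Qed.

Fact fps_one_neq0 : fps_one != 0.
Proof.
apply/eqP => /(congr1 (fun f : fps R => f 0%N)) /= /eqP.
by rewrite oner_eq0.
Qed.

HB.instance Definition _ := GRing.Zmodule_isComNzRing.Build (fps R)
  fps_mulA fps_mulC fps_mul1 fps_mulDl fps_one_neq0.

(* The square root with constant term 1; the default value 0 is used only if
   there is none. *)
Definition fps_sqrt f : fps R :=
  xget 0 [set s : fps R | s 0%N = 1 /\ s ^+ 2 = f]%classic.

End FpsRing.

Arguments fpsX {R}.

Definition catalan (w : seq nat) : bool :=
  if w is a :: s then (a == 0%N) && path (fun u v => (v <= u.+1)%N) a s
  else true.

(* Positions are counted from 0. *)
Definition contains_pattern (X Y : rel nat) (w : seq nat) : bool :=
  has (fun i => X (nth 0%N w i) (nth 0%N w i.+1)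
             && Y (nth 0%N w i.+1) (nth 0%N w i.+2)) (iota 0 (size w - 2)).

Definition des (w : seq nat) : nat :=
  count (fun i => (nth 0%N w i.+1 < nth 0%N w i)%N) (iota 0 (size w - 1)).

(* Justifies enumerating the Catalan words of length n as tuples over 'I_n. *)
Lemma catalan_ltn_size w : catalan w -> all (fun a => (a < size w)%N) w.
Proof.
case: w => [//|a s] /= /andP[/eqP-> ps].
have H : forall b r, path (fun u v => (v <= u.+1)%N) b r ->
    all (fun c => (c <= b + size r)%N) r.
  move=> b r; elim: r b => [//|c r IH] b /= /andP[cb pr].
  apply/andP; split; first by rewrite (leq_trans cb) // addnS ltnS leq_addr.
  apply: sub_all (IH _ pr) => d /leq_trans; apply.
  by rewrite addnS -addSn leq_add2r.
by have := H _ _ ps; rewrite add0n.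
Qed.

Definition word n (w : n.-tuple 'I_n) : seq nat := [seq nat_of_ord i | i <- w].

Lemma word_inj n : injective (@word n).
Proof. by move=> u v /(inj_map val_inj) /val_inj. Qed.

Lemma catalan_wordP n (s : seq nat) :
  size s = n -> catalan s -> exists w : n.-tuple 'I_n, word w = s.
Proof.
move=> <- /catalan_ltn_size /allP lt_s.
exists [tuple of [seq Ordinal (lt_s _ (mem_tnth i (in_tuple s)))
               | i <- ord_tuple (size s)]].
rewrite /word /= -map_comp -[RHS](map_tnth_enum (in_tuple s)).
by apply: eq_map => i.
Qed.

(* C_(X,Y)(x,y), as a power series in x whose coefficients are polynomials
   in y. *)
Definition catalan_gf (X Y : rel nat) : fps {poly rat} :=
  Fps (fun n => \sum_(w : n.-tuple 'I_n | catalan (word w)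
                        && ~~ contains_pattern X Y (word w)) 'X^(des (word w))).

(* The derivative with respect to y at y = 1 of C_(X,Y)(x,y). *)
Definition descent_gf (X Y : rel nat) : fps rat :=
  Fps (fun n => (catalan_gf X Y n)^`().[1]).

Lemma descent_gfE X Y n : descent_gf X Y n =
  (\sum_(w : n.-tuple 'I_n | catalan (word w)
          && ~~ contains_pattern X Y (word w)) des (word w))%:R.
Proof.
rewrite /= raddf_sum horner_sum natr_sum; apply: eq_bigr => w _ /=.
by rewrite derivXn hornerMn hornerXn expr1n.
Qed.

(* Main.v *)
(* A nonempty Catalan word is 0 (u+1) v with u, v Catalan words, u+1 being u
   with all letters incremented. If u is nonempty, the word avoids (=,<=) iff u
   and v do, and the junction of u+1 and v is a descent unless v is empty; if u
   is empty, it avoids (=,<=) iff v is empty or 0. Hence A = C - 1 satisfies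
   A = x + x^2 + x A (1 + y A). At y = 1 this makes s = 1 - x - 2 x A the
   required square root, and differentiating in y gives s D = x A^2. *)
Require Import Defs.
From mathcomp Require Import all_boot all_order all_algebra.
From mathcomp Require Import classical_sets ring.
Set Implicit Arguments.
Unset Strict Implicit.
Unset Printing Implicit Defensive.
Import GRing.Theory.
Local Open Scope ring_scope.

(** * Coefficients, cancellation and square roots of power series *)

Section FpsTheory.
Variable R : comNzRingType.
Implicit Types f g : fps R.

Lemma fps_coefD f g n : (f + g) n = f n + g n. Proof. by []. Qed.

Lemma fps_coefN f n : (- f) n = - f n. Proof. by []. Qed.

Lemma fps_coefM f g n : (f * g) n = \sum_(i < n.+1) f i * g (n - i)%N.
Proof. by []. Qed.

Lemma fps_coef1 n : (1 : fps R) n = (n == 0%N)%:R. Proof. by []. Qed.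

Lemma fps_coefXM0 f : (fpsX * f) 0%N = 0.
Proof. by rewrite fps_coefM big_ord1 mul0r. Qed.

Lemma fps_coefXMS f n : (fpsX * f) n.+1 = f n.
Proof.
rewrite fps_coefM big_ord_recl mul0r add0r big_ord_recl /= mul1r subn1 /=.
by rewrite big1 ?addr0 // => i _; rewrite mul0r.
Qed.

(** With polynomial coefficients, [fpsC 'X] is the variable y seen as a constant series in x. *)
Definition fpsC (c : R) : fps R := Fps (fun n => c *+ (n == 0%N)).

Lemma fps_coefCM c f n : (fpsC c * f) n = c * f n.
Proof.
rewrite fps_coefM big_ord_recl subn0 big1 ?addr0 // => i _.
by rewrite mul0r.
Qed.

End FpsTheory.

(** Once the coefficients of [g] below n vanish, the n-th coefficient of [f * g] reduces to
    [f 0 * g n]. *)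
Lemma fps_mulf_eq0 (R : idomainType) (f g : fps R) :
  f 0%N != 0 -> f * g = 0 -> g = 0.
Proof.
move=> f0 fg0; apply: fpsP => n /=.
elim/ltn_ind: n => n IH.
have /eqP := congr1 (fun h : fps R => h n) fg0.
rewrite fps_coefM big_ord_recl subn0 big1 ?addr0 => [|i _].
  by rewrite mulf_eq0 (negbTE f0) => /eqP.
by rewrite IH ?mulr0 ?ltn_subrL ?(leq_ltn_trans (leq0n i)).
Qed.

(** Two such roots satisfy (t + s)(t - s) = 0, and t + s has constant term 2, so it can be
    cancelled. *)
Lemma fps_sqrtE (f s : fps rat) : s 0%N = 1 -> s ^+ 2 = f -> fps_sqrt f = s.
Proof.
move=> s0 s2; rewrite /fps_sqrt; case: xgetP => [t _ [t0 t2]|/(_ s)]; last first.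
  by case; split.
apply/eqP; rewrite -subr_eq0; apply/eqP/(@fps_mulf_eq0 _ (t + s)).
  by rewrite fps_coefD t0 s0.
by rewrite mulrC -subr_sqr t2 s2 subrr.
Qed.

(** * Evaluation and differentiation in y at y = 1 *)

Section EvalY.
Implicit Types f g : fps {poly rat}.

Definition evalY f : fps rat := Fps (fun n => (f n).[1]).
Definition derivY f : fps rat := Fps (fun n => (f n)^`().[1]).

Lemma evalYD f g : evalY (f + g) = evalY f + evalY g.
Proof. by apply: fpsP => n; rewrite /= hornerD. Qed.

Lemma evalYM f g : evalY (f * g) = evalY f * evalY g.
Proof.
apply: fpsP => n; rewrite /= horner_sum.
by apply: eq_bigr => i _; rewrite hornerM.
Qed.

Lemma derivYD f g : derivY (f + g) = derivY f + derivY g.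
Proof. by apply: fpsP => n; rewrite /= derivD hornerD. Qed.

Lemma derivYM f g : derivY (f * g) = derivY f * evalY g + evalY f * derivY g.
Proof.
apply: fpsP => n; rewrite /= raddf_sum horner_sum -big_split /=.
by apply: eq_bigr => i _; rewrite derivM hornerD !hornerM.
Qed.

Lemma evalYC p : evalY (fpsC p) = fpsC p.[1].
Proof. by apply: fpsP => n; rewrite /= hornerMn. Qed.

Lemma evalY1 : evalY 1 = 1.
Proof. by apply: fpsP => n; rewrite /= -polyC_natr hornerC. Qed.

Lemma evalYX : evalY fpsX = fpsX.
Proof. by apply: fpsP => n; rewrite /= -polyC_natr hornerC. Qed.

Lemma derivY1 : derivY 1 = 0.
Proof. by apply: fpsP => n; rewrite /= -polyC_natr derivC horner0. Qed.

Lemma derivYC p : derivY (fpsC p) = fpsC p^`().[1].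
Proof. by apply: fpsP => n; rewrite /= derivMn hornerMn. Qed.

Lemma derivYX : derivY fpsX = 0.
Proof. by apply: fpsP => n; rewrite /= -polyC_natr derivC horner0. Qed.

End EvalY.

(** * The decomposition 0 (u+1) v and its effect on patterns and descents *)

Lemma contains_pattern_cons3 X Y a b c (w : seq nat) :
  contains_pattern X Y [:: a, b, c & w]
  = (X a b && Y b c) || contains_pattern X Y [:: b, c & w].
Proof.
rewrite /contains_pattern /= !subn2 /= -[1%N]addn0 iotaDl has_map.
by congr orb; apply: eq_has.
Qed.

Lemma des_cons2 a b (w : seq nat) : des [:: a, b & w] = ((b < a) + des (b :: w))%N.
Proof.
rewrite /des /= !subn1 /= -[1%N]addn0 iotaDl count_map.
by congr addn; apply: eq_count.
Qed.

(** The default 0 of [head] lets the empty word qualify. *)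
Definition zero_headed (w : seq nat) := head 0%N w == 0%N.

Lemma catalan_zero_headed w : catalan w -> zero_headed w.
Proof. by case: w => //= a w /andP[]. Qed.

Definition graft (u v : seq nat) := 0%N :: map succn u ++ v.

(** The leading 0 bounds the first letter of u+1 by 1, which forces [u] to start with 0; dropping to
    the 0 that starts [v] is always allowed. *)
Lemma catalan_graft u v : u != [::] -> zero_headed v ->
  catalan (graft u v) = catalan u && catalan v.
Proof.
case: u => [//|a u] _ v0; rewrite /catalan /= ltnS leqn0 cat_path path_map -!andbA.
do 2![congr andb].
by case: v v0 => [|b v] //= /eqP /= ->.
Qed.

Definition eq_leq_free (w : seq nat) := ~~ contains_pattern eq_op leq w.

(** No window across the junction is an occurrence: in (a+1, b+1, 0) the relation <= fails, in (a+1,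
    0, c) equality fails. *)
Lemma eq_leq_free_cat u v : zero_headed v ->
  eq_leq_free (map succn u ++ v) = eq_leq_free u && eq_leq_free v.
Proof.
rewrite /eq_leq_free -negb_or => v0; congr negb.
elim: u => [//|a [|b [|c u]] IH].
- by case: v v0 {IH} => [|b [|c v]] //= /eqP /= ->; rewrite contains_pattern_cons3.
- move: IH; case: v v0 => [//|c v] /= /eqP /= ->.
  by rewrite contains_pattern_cons3 ltn0 andbF.
by rewrite contains_pattern_cons3 -orbA -IH !map_cons !cat_cons contains_pattern_cons3.
Qed.

(** The leading 0 is followed by a positive letter, so the first window fails equality. *)
Lemma eq_leq_free_graft u v : u != [::] -> zero_headed v ->
  eq_leq_free (graft u v) = eq_leq_free u && eq_leq_free v.
Proof.
move=> u0 v0; rewrite -eq_leq_free_cat // /graft /eq_leq_free.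
case: u u0 => [//|a u] _ /=; case: (map _ _ ++ v) => [|c w] //.
by rewrite contains_pattern_cons3.
Qed.

Lemma des_graft u v : u != [::] -> zero_headed v ->
  des (graft u v) = (des u + (v != [::]) + des v)%N.
Proof.
case: u => [//|a u] _ v0; rewrite /graft map_cons cat_cons des_cons2 ltn0 add0n.
elim: u a => [|b u IH] a.
  by case: v v0 => [|b v] //= /eqP /= ->; rewrite des_cons2.
by rewrite map_cons cat_cons !des_cons2 IH ltnS !addnA.
Qed.

(** The letters of u+1 are positive, so [v] starts at the first 0 after the head; if there is none,
    [find] returns the full length and [v] is empty. *)
Definition ungraft (w : seq nat) :=
  let k := find (pred1 0%N) (behead w) in
  (map predn (take k (behead w)), drop k (behead w)).

Lemma graftK u v : zero_headed v -> ungraft (graft u v) = (u, v).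
Proof.
move=> v0; rewrite /ungraft /=.
have -> : find (pred1 0%N) (map succn u ++ v) = size (map succn u).
  elim: u => [|a u /= -> //].
  by case: v v0 => [|b v] //= /eqP /= ->.
by rewrite take_size_cat // drop_size_cat // mapK.
Qed.

Lemma ungraftK w : w != [::] -> zero_headed w ->
  graft (ungraft w).1 (ungraft w).2 = w.
Proof.
case: w => [//|a w] _ /eqP /= ->; rewrite /graft /=; congr (_ :: _).
by elim: w => [//|[|b] w IH] //=; rewrite IH.
Qed.

Lemma ungraft_zero_headed w : zero_headed (ungraft w).2.
Proof. by rewrite /ungraft /=; elim: (behead w) => [//|[|a] s]. Qed.

(** * Enumeration of the avoiding words by length *)

Definition avoider w := catalan w && eq_leq_free w.

Lemma avoider_graft u v : u != [::] -> zero_headed v ->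
  avoider (graft u v) = avoider u && avoider v.
Proof.
by move=> u0 v0; rewrite /avoider catalan_graft // eq_leq_free_graft // andbACA.
Qed.

(** A nonempty [v] makes the word start with 00, and any third letter then completes an
    occurrence. *)
Lemma avoider_graft0 v : zero_headed v ->
  avoider (graft [::] v) = (v \in [:: [::]; [:: 0%N]]).
Proof.
rewrite /graft /avoider /eq_leq_free.
case: v => [//|a [|b v]] /eqP /= -> //.
by rewrite contains_pattern_cons3 /= andbF.
Qed.

Definition avoiders n : seq (seq nat) :=
  [seq word w | w in [pred w : n.-tuple 'I_n | avoider (word w)]].

Lemma avoiders_uniq n : uniq (avoiders n).
Proof. by rewrite map_inj_uniq ?enum_uniq //; apply: word_inj. Qed.

Lemma mem_avoiders n w : (w \in avoiders n) = (size w == n) && avoider w.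
Proof.
apply/mapP/andP => [[t + ->]|[/eqP sw aw]].
  by rewrite mem_enum inE => at_; rewrite size_map size_tuple eqxx.
have /andP[cw _] := aw.
by have [t tw] := catalan_wordP sw cw; exists t; rewrite ?mem_enum ?inE tw.
Qed.

Lemma catalan_gfE n :
  catalan_gf eq_op leq n = \sum_(w <- avoiders n) 'X^(des w).
Proof. by rewrite /= big_map big_enum. Qed.

Lemma avoiders_zero_headed n w : w \in avoiders n -> zero_headed w.
Proof. by rewrite mem_avoiders => /andP[_ /andP[/catalan_zero_headed]]. Qed.

(** Both lists are duplicate-free with the same members: the first piece on the right collects the
    words with [u] empty, the second those with [u] of length i >= 1. *)
Lemma perm_avoidersS n : perm_eq (avoiders n.+1)
  ([seq w <- [:: [:: 0%N]; [:: 0%N; 0%N]] | size w == n.+1]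
   ++ [seq graft p.1 p.2 | i <- iota 1 n,
        p <- [seq (u, v) | u <- avoiders i, v <- avoiders (n - i)]]).
Proof.
apply: uniq_perm; first exact: avoiders_uniq.
- rewrite cat_uniq filter_uniq // andTb; apply/andP; split.
    (* The two pieces are disjoint: with [u] nonempty, the second letter exists and is positive. *)
    apply/hasPn => w hw; rewrite [_ \in _]mem_filter negb_and orbC !inE.
    case/allpairsPdep: hw => [i [_ [+ /allpairsP[[u v] [/= hu hv ->]] ->]]].
    rewrite mem_iota => /andP[i0 _].
    move: hu; rewrite mem_avoiders => /andP[/eqP su _].
    by case: u su i0 => [<-|].
  apply: allpairs_uniq_dep => [|i _|]; first exact: iota_uniq.
    by apply: allpairs_uniq; rewrite ?avoiders_uniq // => -[? ?] [].
  move=> p q /allpairsPdep[i [_ [_ /allpairsP[[u v] [/= hu hv ->]] ->]]].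
  move=> /allpairsPdep[j [_ [_ /allpairsP[[u' v'] [/= hu' hv' ->]] ->]]] /=.
  (* [ungraft] recovers [u] and [v], and the index i is the length of [u]. *)
  move=> /(congr1 ungraft); rewrite !graftK.
  - case=> uu' vv'; subst u' v'.
    by move: hu hu'; rewrite !mem_avoiders => /andP[/eqP<- _] /andP[/eqP<- _].
  - exact: avoiders_zero_headed hv'.
  exact: avoiders_zero_headed hv.
move=> w; rewrite mem_cat mem_filter mem_avoiders.
apply/idP/idP => [/andP[sw aw]|/orP[/andP[->]|]].
- have v0 := ungraft_zero_headed w; have := aw.
  have /andP[/catalan_zero_headed w0 _] := aw.
  have wn0 : w != [::] by case: (w) sw.
  move: sw; rewrite -(ungraftK wn0 w0); move: v0.
  case: (ungraft w) => u v /= v0.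
  have [->|un0] := eqVneq u [::].
    by rewrite avoider_graft0 // => -> /=; rewrite !inE /graft => /orP[]/eqP->;
      rewrite ?eqxx ?orbT.
  rewrite avoider_graft // eqSS size_cat size_map => /eqP sw /andP[au av].
  apply/orP; right; apply/allpairsPdep; exists (size u), (u, v); split => //.
    by rewrite mem_iota add1n ltnS -sw leq_addr andbT; case: (u) un0.
  apply/allpairsP; exists (u, v) => /=.
  by rewrite !mem_avoiders eqxx au av -sw addKn eqxx.
- by rewrite !inE => /orP[]/eqP->.
case/allpairsPdep=> i [_ [+ /allpairsP[[u v] [/= hu hv ->]] ->]] /=.
have v0 := avoiders_zero_headed hv; move: hu hv; rewrite !mem_avoiders mem_iota.
move=> /andP[/eqP<- au] /andP[/eqP sv av] /andP[u0 un].
rewrite avoider_graft ?au ?av //; last by case: (u) u0.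
by rewrite size_cat size_map sv subnKC ?eqxx // -ltnS -add1n.
Qed.

Lemma avoiders0 : avoiders 0 = [:: [::]].
Proof.
apply: perm_small_eq => //; apply: uniq_perm; rewrite ?avoiders_uniq // => w.
by rewrite mem_avoiders inE; case: w.
Qed.

(** The terms 1, x and x^2 count the empty word, 0 and 00; in the last term, x stands for the
    leading 0, C - 1 for a nonempty [u], and 1 + y (C - 1) for [v] with the junction descent. *)
Lemma catalan_gf_eq :
  let C := catalan_gf eq_op leq in
  let x : fps {poly rat} := fpsX in
  C = 1 + x + x ^+ 2 + x * ((C - 1) * (1 + fpsC 'X * (C - 1))).
Proof.
move=> C x; have C0 : C 0%N = 1.
  by rewrite catalan_gfE avoiders0 big_seq1.
apply: fpsP => -[|n].
  by rewrite !fps_coefD C0 fps_coefXM0 ?expr2 ?fps_coefXM0 !addr0.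
rewrite !fps_coefD expr2 !fps_coefXMS catalan_gfE (perm_big _ (perm_avoidersS n)).
rewrite big_cat big_filter; congr (_ + _).
  rewrite big_cons big_mkcond big_seq1 fps_coef1 add0r.
  by case: n => [|[|n]] /=; rewrite ?addr0 ?add0r.
(* The term of index 0 vanishes with the constant term of C - 1, which matches lengths of [u]
   starting at 1. *)
rewrite fps_coefM big_ord_recl fps_coefD C0 subrr mul0r add0r.
rewrite big_allpairs_dep -[X in iota X]addn0 iotaDl big_map -{1}(subn0 n) big_mkord.
apply: eq_bigr => i _; rewrite big_allpairs_dep.
rewrite fps_coefD fps_coefN subr0 -/C {1}/C catalan_gfE mulr_suml.
apply: eq_big_seq => u hu.
have un0 : u != [::] by case: (u) hu; rewrite ?mem_avoiders.
(* The junction descent is charged to [v]: the empty [v] contributes 1, any other an extra factor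
   y. *)
have -> m : (1 + fpsC 'X * (C - 1)) m
    = \sum_(v <- avoiders m) 'X^((v != [::]) + des v).
  rewrite fps_coefD fps_coefCM fps_coefD fps_coefN fps_coef1.
  case: m => [|m]; first by rewrite C0 subrr mulr0 addr0 avoiders0 big_seq1.
  rewrite add0r subr0 catalan_gfE mulr_sumr; apply: eq_big_seq => -[|a v].
    by rewrite mem_avoiders.
  by rewrite -exprS.
rewrite mulr_sumr; apply: eq_big_seq => v hv.
by rewrite des_graft ?(avoiders_zero_headed hv) // -addnA exprD.
Qed.

Theorem corollary3p6 :
  let x : fps rat := fpsX in
  let s : fps rat := fps_sqrt (1 - 2 * x - 3 * x ^+ 2 - 4 * x ^+ 3) in
  2 * x * s * descent_gf eq_op leq
  = 1 - 2 * x - x ^+ 2 - 2 * x ^+ 3 - (1 - x) * s.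
Proof.
move=> x; set A := evalY (catalan_gf eq_op leq) - 1.
set D := descent_gf _ _.
have fpsC1 : fpsC 1 = 1 :> fps rat by apply: fpsP => n.
have evalYN1 : evalY (-1) = -1.
  by apply: fpsP => n; rewrite /= hornerN -polyC_natr hornerC.
have derivYN1 : derivY (-1) = 0.
  by apply: fpsP => n; rewrite /= derivN hornerN -polyC_natr derivC horner0 oppr0.
have AE : A = x + x ^+ 2 + x * (A * (1 + A)).
  rewrite {1}/A {1}catalan_gf_eq !expr2.
  rewrite !(evalYD, evalYM, evalY1, evalYX, evalYC, evalYN1) hornerX fpsC1.
  rewrite -/x -/A; ring.
(* Product rule at y = 1: the y-derivative of y (C - 1) there is A + D. *)
have DE : D = x * (D * (1 + A) + A * (A + D)).
  rewrite {1}/D {1}[descent_gf _ _](_ : _ = derivY (catalan_gf eq_op leq)) //.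
  rewrite {1}catalan_gf_eq !expr2.
  rewrite !(derivYD, derivYM, derivY1, derivYX, derivYC, derivYN1).
  rewrite !(evalYD, evalYM, evalY1, evalYX, evalYC, evalYN1).
  rewrite hornerX derivX hornerC fpsC1 -/x -/A -[derivY _]/D; ring.
(* [AE] is the quadratic x A^2 - (1 - x) A + x + x^2 = 0, and the radicand is its discriminant (1 -
   x)^2 - 4 x (x + x^2); the sign is fixed by the constant term 1. *)
have -> /= : fps_sqrt (1 - 2 * x - 3 * x ^+ 2 - 4 * x ^+ 3) = 1 - x - 2 * x * A.
  apply: fps_sqrtE.
    by rewrite !fps_coefD !fps_coefN mulrAC mulrC fps_coefXM0 !subr0.
  move: AE; set Q := x * (A * _) => AE.
  have -> : (1 - x - 2 * x * A) ^+ 2 =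
     (1 - x) ^+ 2 - 4 * x * (A - x * (A * (1 + A))) by ring.
  by rewrite {1}AE /Q; ring.
have sD : (1 - x - 2 * x * A) * D = x * A ^+ 2.
  have -> : (1 - x - 2 * x * A) * D
    = D - x * (D * (1 + A) + A * (A + D)) + x * A ^+ 2 by ring.
  by rewrite -DE subrr add0r.
rewrite -[2 * x * _ * D]mulrA sD.
(* Through [AE], x A^2 becomes linear in A, after which both sides agree as polynomials in x and
   A. *)
have -> : 2 * x * (x * A ^+ 2) = 2 * x * (x * (A * (1 + A)) - x * A) by ring.
have -> : x * (A * (1 + A)) = A - x - x ^+ 2.
  by rewrite [X in _ = X - _ - _]AE; ring.
ring.
Qed.
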